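(* Let $G$ be a finite group whose Sylow $2$-subgroups are metacyclic, but neither of maximal class nor homocyclic. Then $G$ is $2$-nilpotent.
   Context: A group is metacyclic if it has a cyclic normal subgroup with cyclic quotient. A homocyclic group here means a direct product of two isomorphic cyclic groups. The $2$-groups of maximal class are precisely the dihedral groups (order $\ge 8$), the semidihedral groups (order $\ge 16$) and the (generalized) quaternion groups (order $\ge 8$). A finite group $G$ is $2$-nilpotent if it has a normal subgroup of odd order whose index is a power of $2$ (a normal $2$-complement). *)

(* Defs.v *)
From mathcomp Require Import all_boot all_fingroup all_solvable.

Set Implicit Arguments.
Unset Strict Implicit.
Unset Printing Implicit Defensive.
Local Open Scope group_scope.

(* A 2-group of order 2 ^ n is of maximal class when n >= 3 and its nilpotency
   class is n - 1. Groups of order 4 are not counted as being of maximal class;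
   maximal_class2P below shows that this convention yields exactly the dihedral,
   semidihedral and quaternion groups. *)
Definition maximal_class2 (gT : finGroupType) (P : {group gT}) : Prop :=
  exists n : nat, [/\ 2 < n, #|P| = (2 ^ n)%N & nil_class P = n.-1].

(* Unlike mathcomp's homocyclic, exactly two (possibly trivial) isomorphic
   cyclic factors are required; a nontrivial cyclic 2-group is therefore not
   homocyclic2. *)
Definition homocyclic2 (gT : finGroupType) (P : {group gT}) : Prop :=
  exists A B : {group gT},
    [/\ cyclic A, cyclic B, A \isog B & A \x B = P].

Definition two_nilpotent (gT : finGroupType) (G : {group gT}) : Prop :=
  exists K : {group gT}, [/\ K <| G, odd #|K| & 2.-nat #|G : K|].

Lemma maximal_class2_cyclic n (gT : finGroupType) (P : {group gT}) :
    #|P| = (2 ^ n.+3)%N -> nil_class P = n.+2 ->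
  exists X : {group gT}, [/\ X \subset P, cyclic X & #|P : X| = 2].
Proof.
elim: n gT P => [|n IHn] gT P oP cP.
  have pP: 2.-group P by rewrite /pgroup oP pnatX.
  have nabP: ~~ abelian P by rewrite -nil_class1 cP.
  have [x Px x2]: exists2 x, x \in P & x ^+ 2 != 1.
    apply/exists_inP; rewrite -negb_forall_in; apply: contra nabP => /forall_inP h.
    apply: (@abelem_abelian _ 2); apply: exponent2_abelem.
    by apply/exponentP=> x /h/eqP.
  exists <[x]>%G; rewrite cycle_subG Px cycle_cyclic; split=> //.
  rewrite -divgS ?cycle_subG // oP -orderE.
  have [k kle3 ox]: exists2 k, k <= 3 & #[x] = (2 ^ k)%N.
    have := order_dvdG Px; rewrite oP => /(@dvdn_pfactor 2 _ 3 isT) [k].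
    by exists k.
  have k1: 1 < k.
    rewrite ltnNge; apply: contra x2 => kle1.
    by rewrite -order_dvdn ox (@dvdn_exp2l 2 k 1).
  have k3: k != 3.
    apply: contra nabP => /eqP k3.
    have/eqP <-: <[x]> == P by rewrite eqEcard cycle_subG Px -orderE ox oP k3 /=.
    exact: cycle_abelian.
  by rewrite ox; case: k {ox} kle3 k1 k3 => [|[|[|[|]]]].
have pP: 2.-group P by rewrite /pgroup oP pnatX.
have nilP := pgroup_nil pP.
have nabP: ~~ abelian P by rewrite -nil_class1 cP.
set Z := 'Z(P)%G; have sZP: Z \subset P by apply: center_sub.
have nsZP: Z <| P by apply: center_normal.
have ntP: P :!=: 1 by apply: contra nabP => /eqP->; apply: abelian1.
have ntZ: Z :!=: 1 by rewrite center_nil_eq1.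
have cPZ: nil_class (P / Z) = n.+2 by rewrite nil_class_quotient_center // cP.
have [k oZ]: exists k, #|Z| = (2 ^ k)%N.
  by have/p_natP[k ->] := pgroupS sZP pP; exists k.
have oPZk: #|P / Z| = (2 ^ (n.+4 - k))%N.
  have kle: k <= n.+4.
    by rewrite -(@dvdn_Pexp2l 2) // -oZ -oP cardSg.
  by rewrite card_quotient ?normal_norm // -divgS // oP oZ -expnB.
have [{k oZ oPZk}oZ2 oPZ]: #|Z| = 2 /\ #|P / Z| = (2 ^ n.+3)%N.
  have k_gt0: 0 < k.
    by case: k oZ {oPZk} => // oZ; rewrite -cardG_gt1 oZ in ntZ.
  have := nil_class_pgroup (quotient_pgroup Z pP).
  rewrite cPZ oPZk pfactorK // leq_max /= => le_n.
  suff k1: k = 1%N by split; rewrite ?[LHS]oZ k1 ?subn1.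
  case: k k_gt0 {oZ oPZk} le_n => [|[|k]] //= _.
  rewrite !subSS ltnNge -subnS => /negP[].
  by rewrite leq_subLR addSn ltnS leq_addl.
have [Xb [sXb cXb iXb]] := IHn _ _ oPZ cPZ.
have [X defXb sZX sXP] := inv_quotientS nsZP sXb.
have cXZ: cyclic (X / Z) by rewrite -defXb.
have nsZX: Z <| X by apply: normalS nsZP.
have cXX: abelian X.
  apply: cyclic_factor_abelian cXZ.
  by rewrite subsetI sZX centsC (subset_trans sXP) // centsC subsetIr.
have iX: #|P : X| = 2.
  rewrite -iXb defXb; apply/esym/index_quotient_eq => //.
    by rewrite subIset // sZX orbT.
  exact: normal_norm.
have nsXP: X <| P by apply: index2_normal.
exists X; split=> //; have nZX := normal_norm nsZX.
have [xb defx] := cyclicP cXZ.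
have [x [Nx Xx defxb]]: exists x, [/\ x \in 'N(Z), x \in X & xb = coset Z x].
  have: xb \in X / Z by rewrite defx cycle_id.
  by case/morphimP=> x Nx Xx ->; exists x.
have XE t : t \in X -> exists z k, [/\ z \in Z, t = z * x ^+ k & t ^+ 2 = x ^+ (k * 2)].
  move=> Xt; have Nt: t \in 'N(Z) by apply: subsetP Xt.
  have: coset Z t \in <[xb]> by rewrite -defx mem_quotient.
  case/cycleP=> k; rewrite defxb -morphX // => /(rcoset_kercosetP Nt (groupX k Nx)).
  case/rcosetP=> z Zz ->; exists z, k; split=> //.
  rewrite expgMn -?expgM; last first.
    by apply: (centsP cXX); [apply: subsetP Zz | apply: groupX].
  suff ->: z ^+ 2 = 1 by rewrite mul1g.
  by apply/eqP; rewrite -order_dvdn -oZ2 order_dvdG.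
have oXZ: #|X / Z| = (2 ^ n.+2)%N.
  have:= Lagrange sXb; rewrite iXb oPZ defXb expnSr.
  by move/eqP; rewrite eqn_pmul2r // => /eqP.
have x2Z: x ^+ 2 \notin Z.
  apply/negP=> Zx2; have: #[xb] %| 2.
    by rewrite order_dvdn defxb -morphX //= coset_id.
  by rewrite orderE -defx oXZ (@dvdn_Pexp2l 2 n.+2 1).
have [y Py X'y]: exists2 y, y \in P & y \notin X.
  apply/subsetPn; apply/negP=> sPX; have := indexgg P.
  have defX: P :=: X by apply/eqP; rewrite eqEsubset sPX.
  by rewrite {2}defX iX.
have maxX: maximal X P by apply: p_index_maximal; rewrite ?iX.
have defP: X * <[y]> = P.
  by apply: mulg_normal_maximal; rewrite // cycle_subG.
have Xw t : t \in X -> t ^ y \in X.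
  by move=> Xt; rewrite memJ_norm // (subsetP (normal_norm nsXP)).
set w := [~ x, y]; have X_w : w \in X by rewrite groupM ?groupV ?Xw.
have wE k : [~ x ^+ k, y] = w ^+ k.
  by apply: commXg; apply: (centsP cXX).
have w2: w ^+ 2 != 1.
  apply: contra x2Z; rewrite -wE => /commgP cx2y.
  apply/setIP; split; first by rewrite groupX ?(subsetP sXP).
  rewrite -defP centM; apply/setIP; split; first by rewrite groupX ?(subsetP cXX).
  by rewrite cent_cycle; apply/cent1P.
have nsW: <[w ^+ 2]> <| P.
  rewrite /normal cycle_subG (subsetP sXP) ?groupX //= -defP mulG_subG.
  rewrite cents_norm /=; last first.
    by rewrite (subset_trans cXX) // centS // cycle_subG groupX.
  rewrite cycle_subG; apply/normP/eqP; rewrite eqEcard cardJg leqnn andbT.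
  rewrite -cycleJ cycle_subG.
  have [z [k [Zz xyE _]]] := XE _ (Xw _ Xx).
  suff ->: (w ^+ 2) ^ y = (w ^+ 2) ^+ k by apply: mem_cycle.
  rewrite conjXg -!expgM mulnC expgM; congr (_ ^+ 2).
  have yy : y ^ y = y by rewrite conjgE mulKg.
  rewrite /w conjRg xyE yy commMgJ wE.
  have /commgP/eqP-> : commute z y; last by rewrite conj1g mul1g.
  by case/centerP: Zz => _; apply.
have sZw: Z \subset <[w ^+ 2]>.
  apply: prime_meetG; rewrite ?oZ2 // setIC.
  by apply: meet_center_nil nsW _ => //; rewrite cycle_eq1.
have sZx: Z \subset <[x]>.
  apply: subset_trans sZw _; have [z [k [_ _ ->]]] := XE _ X_w.
  by rewrite cycle_subG mem_cycle.
apply: cyclicS (cycle_cyclic x); apply/subsetP=> t /XE[z [k [Zz -> _]]].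
by rewrite groupM ?mem_cycle // (subsetP sZx).
Qed.

Lemma maximal_class2P (gT : finGroupType) (P : {group gT}) :
  maximal_class2 P <->
  [\/ exists2 n, 2 < n & P \isog 'D_(2 ^ n),
      exists2 n, 3 < n & P \isog 'SD_(2 ^ n)
    | exists2 n, 2 < n & P \isog 'Q_(2 ^ n)].
Proof.
split=> [[[|[|[|n]]] [// _ oP cP]] | [] [n n_gt isoP]].
- have [X [sXP cycX iX]] := maximal_class2_cyclic oP cP.
  have pP: 2.-group P by rewrite /pgroup oP pnatX.
  have nabP: ~~ abelian P by rewrite -nil_class1 cP.
  have D8 m : 1 < m -> P \isog 'D_(2 ^ m) -> 2 < m.
    move=> m_gt1 /card_isog; rewrite oP card_2dihedral // => /eqP.
    by rewrite eqn_exp2l // => /eqP <-.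
  have := maximal_cycle_extremal pP nabP cycX sXP iX.
  case/orP=> [/eqP/modular_group_classP[q q_pr [m m_gt isoM]] | /=].
    have m_gt2 : 2 < m by apply: leq_trans m_gt; apply: leq_addl.
    have [[x y] genP modP] := generators_modular_group q_pr m_gt2 isoM.
    have [_ _ [_ _ nil2] _ _] := modular_group_structure q_pr m_gt2 genP isoM modP.
    have := card_isog isoM; rewrite card_modular_group // oP => oPm.
    have q2: q = 2.
      have := congr1 pdiv oPm; rewrite pdiv_pfactor //.
      by rewrite -[m](ltn_predK m_gt2) pdiv_pfactor.
    move/eqP: oPm m_gt; rewrite q2 eqn_exp2l // => /eqP <-.
    by move: cP; rewrite nil2 => -[<-].
  rewrite /extremal2 => ext; case def_c: (extremal_class P) ext => // _.
  + by case/dihedral_classP: def_c => m m_gt isoP; constructor 1; exists m; auto.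
  + by case/semidihedral_classP: def_c => m; constructor 2; exists m.
  + by case/quaternion_classP: def_c => m; constructor 3; exists m.
- exists n; split=> //; first by rewrite (card_isog isoP) card_2dihedral // ltnW.
  have [[x y] genP _] := generators_2dihedral (ltnW n_gt) isoP.
  by have [_ [_ _ _ ->]] := dihedral2_structure (ltnW n_gt) genP isoP.
- exists n; split; first exact: ltnW; first by rewrite (card_isog isoP) card_semidihedral.
  have [[x y] genP [oy _]] := generators_semidihedral n_gt isoP.
  by have [_ [_ _ _ ->]] := semidihedral_structure n_gt genP isoP oy.
exists n; split=> //; first by rewrite (card_isog isoP) card_quaternion.
have [[x y] genP _] := generators_quaternion n_gt isoP.
by have [_ [_ _ _ ->]] := quaternion_structure n_gt genP isoP.
Qed.

(* Main.v *)
Require Import Defs.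
From mathcomp Require Import all_boot all_fingroup all_solvable.

Set Implicit Arguments.
Unset Strict Implicit.
Unset Printing Implicit Defensive.
Local Open Scope group_scope.

(** The proof combines Frobenius' normal p-complement theorem with a study of
    how odd-order groups act on metacyclic 2-groups.

    By Frobenius' theorem (Frobenius_normal_complement), it is enough that for
    every 2-subgroup X of G the odd-order subgroups of 'N_G(X) centralize X.
    Suppose this fails for some X, taken of maximal order, and let P be a Sylow
    2-subgroup of G containing a Sylow 2-subgroup R of 'N_G(X). Then X is
    metacyclic, like P, and has a nontrivial odd-order group D of operators.

    Such an X is very restricted (odd_action_metacyclic). As X / 'Phi(X) has
    order at most 4, X = [X, D]; as odd-order groups act trivially on cyclic
    2-groups, every D-equivariant homomorphism from X to a cyclic subgroup of X
    is trivial. Applying this to power maps shows that X is either homocyclic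
    or nonabelian of order 8.

    If X is nonabelian of order 8 then P, being metacyclic, has maximal class
    (metacyclic_maximal_class), which is excluded. So X is homocyclic, hence
    proper in P and in R = 'N_P(X). The Frattini argument and the maximal choice
    of X show that an element of R acting trivially on X / 'Phi(X) lies in X.
    Let R1 contain X with index 2 in R: it acts nontrivially on X / 'Phi(X). If
    #|X| > 4, this contradicts the fact that a metacyclic 2-group containing X
    with index 2 acts trivially on X / 'Phi(X) (commg_homocyclic_index2); if
    #|X| = 4, then R1 is nonabelian of order 8, and P has maximal class again. *)

(** * Frobenius' normal p-complement theorem *)

(** For p prime, this says that 'N_G(X) / 'C_G(X) is a p-group for every
    p-subgroup X of G; in this form it obviously passes to subgroups of G. *)
Definition p'_locally_central p (gT : finGroupType) (G : {group gT}) :=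
  forall X D : {group gT}, X \subset G -> p.-group X ->
    D \subset 'N_G(X) -> p^'.-group D -> D \subset 'C(X).

Section Frobenius.

Variables (p : nat) (gT : finGroupType).
Implicit Types G H P Q S X : {group gT}.

(** Otherwise some prime q other than p divides the order of G / H, and a Sylow
    q-subgroup of G has nontrivial image. *)
Lemma pgroup_quotient_p'sub G H :
    G \subset 'N(H) ->
    (forall D : {group gT}, D \subset G -> p^'.-group D -> D \subset H) ->
  p.-group (G / H).
Proof.
move=> nHG sp'H; apply/pgroupP=> q q_pr q_dv; apply/idPn=> p'q.
have [Q sylQ] := Sylow_exists q G.
have sQH: Q \subset H.
  apply: sp'H (pHall_sub sylQ) _; apply: sub_in_pnat (pHall_pgroup sylQ) => r _.
  by move/eqnP->.
have := quotient_pHall (subset_trans (pHall_sub sylQ) nHG) sylQ.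
move/card_Hall; rewrite /= quotientS1 // cards1 => /esym/eqP.
by rewrite p_part_eq1 mem_primes q_pr cardG_gt0 q_dv.
Qed.

Lemma Sylow_norm_cent G X S :
    p'_locally_central p G -> X \subset G -> p.-group X ->
  p.-Sylow('N_G(X)) S -> 'C_G(X) * S = 'N_G(X).
Proof.
move=> locG sXG pX sylS; have [sSN pS _] := and3P sylS.
have sCN: 'C_G(X) \subset 'N_G(X) by rewrite setIS ?cent_sub.
have nCN: 'N_G(X) \subset 'N('C_G(X)).
  by rewrite normsI ?norms_cent ?subsetIr // subIset ?normG.
have pNC: p.-group ('N_G(X) / 'C_G(X)).
  apply: pgroup_quotient_p'sub => // D sDN p'D; rewrite subsetI.
  by rewrite (locG X D) // (subset_trans sDN) ?subsetIl.
have := quotient_pHall (subset_trans sSN nCN) sylS.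
rewrite pHallE part_pnat_id // => /andP[sSNC /eqP oS].
rewrite -quotientK ?(subset_trans sSN) //.
have ->: S / 'C_G(X) = 'N_G(X) / 'C_G(X) by apply/eqP; rewrite eqEcard sSNC oS /=.
by rewrite quotientGK // /normal sCN.
Qed.

(** Downward induction on the order of X = P :&: Q. Both 'N_P(X) and 'N_Q(X)
    are larger than X and lie in Sylow subgroups S and T of 'N_G(X), which are
    conjugate under 'C_G(X) because 'N_G(X) = 'C_G(X) * S. If P1 is a Sylow
    subgroup of G containing S, then P and P1 meet in more than X, and so do
    Q and a suitable 'C_G(X)-conjugate of P1, so induction applies twice. *)
Lemma Sylow_trans_cent G P Q :
    p'_locally_central p G -> p.-Sylow(G) P -> p.-Sylow(G) Q ->
  exists2 c, c \in 'C_G(P :&: Q) & Q = (P :^ c)%G.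
Proof.
move=> locG; have [n] := ubnP (#|G| - #|P :&: Q|).
elim: n => // n IHn in P Q * => lePQn sylP sylQ.
have [[sPG pP _] [sQG pQ _]] := (and3P sylP, and3P sylQ).
pose X := (P :&: Q)%G; have sXP: X \subset P by apply: subsetIl.
have sXQ: X \subset Q by apply: subsetIr.
have [sPQ | nsPQ] := boolP (P \subset Q).
  exists 1; rewrite ?group1 //; apply: val_inj; rewrite /= conjsg1; apply/esym/eqP.
  by rewrite eqEcard sPQ (card_Hall sylP) (card_Hall sylQ) /=.
(* The induction hypothesis for intersections that properly contain X. *)
have IH P1 Q1 : X \proper P1 :&: Q1 -> p.-Sylow(G) P1 -> p.-Sylow(G) Q1 ->
  exists2 c, c \in 'C_G(X) & Q1 = (P1 :^ c)%G.
- move=> prX sylP1 sylQ1; have [||//|c Cc ->] := IHn P1 Q1.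
  + rewrite ltnS in lePQn; apply: leq_trans lePQn; apply: ltn_sub2l; last exact: proper_card.
    apply: leq_trans (proper_card prX) (subset_leq_card _).
    by rewrite subIset ?(pHall_sub sylP1).
  + by [].
  + by exists c => //; apply: subsetP Cc; rewrite setIS // centS ?proper_sub.
have prXP: X \proper 'N_P(X).
  apply: nilpotent_proper_norm (pgroup_nil pP) _; rewrite properEneq sXP andbT.
  by apply: contra nsPQ => /eqP <-.
have prXQ: X \proper 'N_Q(X).
  apply: nilpotent_proper_norm (pgroup_nil pQ) _; rewrite properEneq sXQ andbT.
  apply: contra nsPQ => /eqP defX; have sQP: Q \subset P by rewrite -defX.
  have /eqP-> : P == Q :> {set gT}; last by [].
  by rewrite eq_sym eqEcard sQP (card_Hall sylP) (card_Hall sylQ) /=.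
have sXG: X \subset G := subset_trans sXP sPG.
have pX: p.-group X := pgroupS sXP pP.
have [S sylS sPS] : {S : {group gT} | p.-Sylow('N_G(X)) S & 'N_P(X) \subset S}.
  by apply: Sylow_superset; rewrite ?setSI // (pgroupS (subsetIl _ _)).
have [T sylT sQT] : {T : {group gT} | p.-Sylow('N_G(X)) T & 'N_Q(X) \subset T}.
  by apply: Sylow_superset; rewrite ?setSI // (pgroupS (subsetIl _ _)).
have defN := Sylow_norm_cent locG sXG pX sylS.
have [x Nx defT] := Sylow_trans sylS sylT.
have [c Cc {x Nx}defT]: exists2 c, c \in 'C_G(X) & T :=: S :^ c.
  have nCS: S \subset 'N('C_G(X)).
    rewrite (subset_trans (pHall_sub sylS)) // normsI ?norms_cent ?subsetIr //.
    by rewrite subIset ?normG.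
  move: Nx; rewrite /= -defN -(normC nCS) => /mulsgP[s c Ss Cc def_x].
  by exists c; rewrite // defT def_x conjsgM conjGid.
have sNG: 'N_G(X) \subset G := subsetIl _ _.
have [P1 sylP1 sSP1] :=
  Sylow_superset (subset_trans (pHall_sub sylS) sNG) (pHall_pgroup sylS).
have [|c1 Cc1 defP1] := IH P P1 _ sylP sylP1.
  apply: proper_sub_trans prXP _; rewrite subsetI subsetIl.
  exact: subset_trans sPS sSP1.
have Gc: c \in G by case/setIP: Cc.
have sylP1c: p.-Sylow(G) (P1 :^ c)%G by rewrite pHallJ.
have [|c2 Cc2 defQ] := IH _ Q _ sylP1c sylQ.
  apply: proper_sub_trans prXQ _; rewrite subsetI subsetIl andbT.
  by apply: subset_trans sQT _; rewrite defT conjSg.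
exists (c1 * c * c2); first by rewrite !groupM.
by apply: val_inj; rewrite defQ defP1 /= !conjsgM.
Qed.

(** P controls its own fusion: x is in the intersection of P and P^(g^-1),
    which are conjugate by an element c centralizing x; then c * g normalizes P,
    and 'N_G(P) = 'C_G(P) * P. *)
Lemma Sylow_fusion G P :
    p'_locally_central p G -> p.-Sylow(G) P ->
  {in P & G, forall x g, x ^ g \in P -> exists2 u, u \in P & x ^ g = x ^ u}.
Proof.
move=> locG sylP x g Px Gg Pxg; have [sPG pP _] := and3P sylP.
have sylPg: p.-Sylow(G) (P :^ g^-1)%G by rewrite pHallJ ?groupV.
have [c /setIP[Gc cPc] /(congr1 val)/= defPc] := Sylow_trans_cent locG sylP sylPg.
have xc: x ^ c = x.
  apply/conjg_fixP/commgP/esym/(centP cPc).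
  by rewrite inE Px mem_conjg invgK.
have Ncg: c * g \in 'N_G(P).
  by rewrite inE groupM //= inE conjsgM -defPc conjsgKV.
have sylP_N: p.-Sylow('N_G(P)) P.
  by apply: pHall_subl (subsetIl _ _) sylP; rewrite subsetI sPG normG.
move: Ncg; rewrite -(Sylow_norm_cent locG sPG pP sylP_N).
case/mulsgP=> v u /setIP[_ cPv] Pu cg_vu.
exists u => //; rewrite -{1}xc -conjgM cg_vu conjgM; congr (_ ^ u).
by apply/conjg_fixP/commgP/esym/(centP cPv).
Qed.

(** The transfer from G to P / P' sends an element x of P to a product of
    conjugates in P of powers of x, the exponents adding up to #|G : P|. As these
    conjugations are realized in P, its value is the class of x ^+ #|G : P|,
    which is nontrivial when x is not in P' since #|G : P| is prime to p. The
    kernel of the transfer is the required normal subgroup. *)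
Lemma fusion_control_p_quotient G P :
    p.-Sylow(G) P -> P :!=: 1 ->
    {in P & G, forall x g, x ^ g \in P -> exists2 u, u \in P & x ^ g = x ^ u} ->
  exists H : {group gT}, [/\ H <| G, H \proper G & p.-nat #|G : H|].
Proof.
move=> sylP ntP fusP; have [sPG pP p'iP] := and3P sylP.
have abP: abelian (coset P^`(1) @* P) := der_abelian 0 P.
have nP'P: P \subset 'N(P^`(1)) := der_norm 1 P.
pose f := restrm_morphism nP'P (coset_morphism P^`(1)).
have abf : abelian (f @* P) by rewrite morphim_restrm setIid.
pose V := transfer_morphism G abf.
(* The transfer takes its values in an additive copy of P / P^`(1); w is its
   multiplicative version. *)
pose w x := FiniteModule.fmval (V x).
have wM : {in G &, {morph w : x y / x * y}}.
  by move=> x y Gx Gy; rewrite /w morphM.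
pose W := Morphism wM.
have WG : W @* G \subset P / P^`(1).
  apply/subsetP=> _ /morphimP[x _ _ ->] /=.
  have -> : P / P^`(1) = f @* P by rewrite /f morphim_restrm setIid.
  exact: FiniteModule.fmodP.
have WE x : x \in P -> W x = coset P^`(1) x ^+ #|G : P|.
  move=> Px; have Gx := subsetP sPG x Px.
  have trX := transversalP (rcosets_cycle_partition sPG Gx).
  rewrite /= /w /V /= (transfer_cycle_expansion sPG abf Gx trX).
  rewrite FiniteModule.fmval_sum -(sum_index_rcosets_cycle sPG Gx trX).
  rewrite -prodgXr; apply: eq_bigr => y Xy; set n := #|_ : _|.
  have Gy: y \in G := subsetP (transversal_sub trX) y Xy.
  have Pxny: (x ^+ n) ^ y^-1 \in P.
    rewrite conjgE invgK mulgA -mem_rcoset; exact: mulg_exp_card_rcosets.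
  (* Control of fusion replaces the conjugation by y^-1 with one inside P. *)
  have [u Pu ->] := fusP _ _ (groupX n Px) (groupVr Gy) Pxny.
  rewrite /restrm /= FiniteModule.fmodK ?mem_morphim ?groupJ ?groupX //=.
  have [nx nu] := (subsetP nP'P x Px, subsetP nP'P u Pu).
  rewrite /restrm /= morphJ ?groupX // morphX //; apply/conjg_fixP/commgP.
  by apply: (centsP abP); rewrite ?groupX ?mem_morphim.
have pPG: p.-nat #|P / P^`(1)| by apply: quotient_pgroup.
exists ('ker W)%G; split; first exact: ker_normal.
  rewrite properEneq subsetIl andbT; apply: contra ntP => /eqP kerG.
  apply/idPn=> ntP1; have: P^`(1) \proper P.
    by rewrite (nil_comm_properl (pgroup_nil pP)) // subsetI subxx normG.
  rewrite properE => /andP[_ /subsetPn[x Px P'x]].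
  case/negP: P'x; have Gx := subsetP sPG x Px.
  have: x \in 'ker W by rewrite kerG.
  move/mker; rewrite WE // => xn1; have nx := subsetP nP'P x Px.
  apply: coset_idr => //; apply/eqP; rewrite -order_eq1; apply/eqP.
  apply: (@pnat_1 p); first exact: mem_p_elt pPG (mem_quotient _ Px).
  by apply: pnat_dvd p'iP; rewrite order_dvdn xn1.
have := card_morphim W G; rewrite setIid => <-.
exact: pnat_dvd (cardSg WG) pPG.
Qed.

Lemma p'_locally_central_sub G H :
  H \subset G -> p'_locally_central p G -> p'_locally_central p H.
Proof.
move=> sHG locG X D sXH pX sDN; apply: locG => //; first exact: subset_trans sHG.
by rewrite (subset_trans sDN) ?setSI.
Qed.

(** If p divides #|G|, control of fusion yields a proper normal subgroup H of
    p-power index; by induction 'O_p^'(H) has p-power index in H, hence in G, and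
    it is contained in 'O_p^'(G). *)
Theorem Frobenius_normal_complement G :
  p'_locally_central p G -> p.-nat #|G : 'O_p^'(G)|.
Proof.
have [n] := ubnP #|G|; elim: n => // n IHn in G * => leGn locG.
have [P sylP] := Sylow_exists p G.
have [P1 | ntP] := eqVneq (P : {set gT}) 1.
  have p'G : p^'.-group G.
    have := card_Hall sylP; rewrite P1 cards1 => /esym/eqP.
    rewrite p_part_eq1 => p'G; apply/pgroupP=> q q_pr q_dv; apply: contra p'G.
    by move=> /eqnP <-; rewrite mem_primes q_pr cardG_gt0.
  by rewrite pcore_pgroup_id // indexgg.
have [H [nsHG prHG pGH]] := fusion_control_p_quotient sylP ntP (Sylow_fusion locG sylP).
have pHO: p.-nat #|H : 'O_p^'(H)|.
  apply: IHn (p'_locally_central_sub (proper_sub prHG) locG).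
  exact: leq_trans (proper_card prHG) _.
have sOO: 'O_p^'(H) \subset 'O_p^'(G).
  by rewrite pcore_max ?pcore_pgroup // gFnormal_trans.
apply: pnat_dvd (indexgS G sOO) _.
by rewrite -(Lagrange_index (normal_sub nsHG) (pcore_sub _ _)) pnatM pGH.
Qed.

End Frobenius.

(** * Coprime action and metacyclic 2-groups *)

Section Metacyclic.

Variable gT : finGroupType.
Implicit Types D H X : {group gT}.

(** D acts trivially on X / H, and fixed points lift by coprimality. *)
Lemma coprime_cent_factor D H X :
    H \subset X -> D \subset 'N(H) -> coprime #|X| #|D| ->
    solvable X -> X \subset 'N(H) -> [~: X, D] \subset H ->
  H * 'C_X(D) = X.
Proof.
move=> sHX nHD coXD solX nHX sXDH.
have nHC: 'C_X(D) \subset 'N(H) by rewrite subIset ?nHX.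
rewrite -quotientK // coprime_quotient_cent //.
rewrite (setIidPl _) ?quotientGK // ?/normal ?sHX //.
by rewrite quotient_cents2.
Qed.

(** 'C_X(D) covers X / 'Phi(X), and 'Phi(X) consists of non-generators. *)
Lemma coprime_cent_Phi (p : nat) D X :
    p.-group X -> coprime #|X| #|D| -> D \subset 'N(X) ->
  [~: X, D] \subset 'Phi(X) -> D \subset 'C(X).
Proof.
move=> pX coXD nXD sXD; have solX := pgroup_sol pX.
have nPhiX: X \subset 'N('Phi(X)) := normal_norm (Phi_normal X).
have nPhiD: D \subset 'N('Phi(X)) := char_norm_trans (Phi_char X) nXD.
have defX := coprime_cent_factor (Phi_sub X) nPhiD coXD solX nPhiX sXD.
have: <<'C_X(D)>> = X.
  by apply: Phi_nongen; rewrite -[RHS]defX norm_joinEr // subIset ?nPhiX.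
rewrite genGid centsC => <-; exact: subsetIr.
Qed.

Lemma index_cent_cyclic D X :
  cyclic X -> D \subset 'N(X) -> #|D : 'C_D(X)| %| totient #|X|.
Proof.
move=> cycX nXD; have nCD: D \subset 'N('C_D(X)) by rewrite normsI ?normG ?norms_cent.
rewrite -card_Aut_cyclic // -card_quotient //.
rewrite /= -ker_conj_aut (card_isog (first_isog_loc _ _)) //.
exact: cardSg (Aut_conj_aut _ _).
Qed.

(** The automorphism group of a cyclic 2-group is a 2-group. *)
Lemma odd_cent_cyclic D X :
    2.-group X -> 2^'.-group D -> cyclic X -> D \subset 'N(X) -> D \subset 'C(X).
Proof.
move=> pX oddD cycX nXD.
have iDC: #|D : 'C_D(X)| = 1%N.
  apply: (@pnat_1 2); last by apply: pnat_dvd oddD; apply: dvdn_indexg.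
  apply: pnat_dvd (index_cent_cyclic cycX nXD) _.
  have [[|k] ->] := p_natP pX; first by [].
  by rewrite totient_pfactor // mul1n pnatX.
by move/eqP: iDC; rewrite indexg_eq1 subsetI subxx.
Qed.

Lemma metacyclic_grank X : metacyclic X -> 'm(X) <= 2.
Proof.
case/metacyclicP=> K [/cyclicP[a defK] /andP[sKX nKX] /cyclicP[bb defXK]].
have: bb \in X / K by rewrite defXK cycle_id.
case/morphimP=> b Nb Xb def_b; have <- : <<[set a; b]>> = X.
  rewrite -[LHS]/([set a] <*> [set b]) -joing_idl -joing_idr.
  rewrite -[LHS]/(<[a]> <*> <[b]>) -defK norm_joinEr ?cycle_subG //.
  rewrite -quotientK ?cycle_subG // quotient_cycle // -def_b -defXK.
  by rewrite quotientGK // /normal sKX.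
by apply: leq_trans (grank_min _) _; rewrite cards2; case: (_ != _).
Qed.

Lemma metacyclic_Phi_index (p : nat) X :
  p.-group X -> metacyclic X -> #|X / 'Phi(X)| %| p ^ 2.
Proof.
move=> pX /metacyclic_grank mX.
have abX := Phi_quotient_abelem pX.
rewrite -(part_pnat_id (quotient_pgroup 'Phi(X) pX)) p_part dvdn_exp2l //.
rewrite -(p_rank_abelem abX).
have mXPhi := leq_trans (quotient_grank (normal_norm (Phi_normal X))) mX.
apply: leq_trans mXPhi; rewrite grank_abelian ?(abelem_abelian abX) //.
exact: p_rank_le_rank.
Qed.

End Metacyclic.

(** If [X, D] were proper, then so would be H = [X, D] 'Phi(X), and H / 'Phi(X)
    would have order at most 2, because #|X / 'Phi(X)| divides 4. Then D would
    centralize both H / 'Phi(X) and X / H, hence X by coprimality. *)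
Lemma odd_commg_metacyclic (gT : finGroupType) (D X : {group gT}) :
    2.-group X -> metacyclic X -> 2^'.-group D -> D \subset 'N(X) ->
  ~~ (D \subset 'C(X)) -> [~: X, D] = X.
Proof.
move=> pX mX oddD nXD not_cXD; apply/eqP; apply/idPn=> neqXD.
have coXD: coprime #|X| #|D| := pnat_coprime pX oddD.
have sWX: [~: X, D] \subset X by rewrite commg_subl.
have [nWX nWD]: X \subset 'N([~: X, D]) /\ D \subset 'N([~: X, D]).
  by rewrite commg_norml commg_normr.
have nPhiX: X \subset 'N('Phi(X)) := normal_norm (Phi_normal X).
have nPhiD: D \subset 'N('Phi(X)) := char_norm_trans (Phi_char X) nXD.
pose H : {group gT} := ( [~: X, D] <*> 'Phi(X))%G.
have sHX: H \subset X by rewrite join_subG sWX Phi_sub.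
have [nHX nHD]: X \subset 'N(H) /\ D \subset 'N(H) by rewrite !normsY.
have prHX: H \proper X.
  rewrite properEneq sHX andbT; apply: contra neqXD => /eqP defX.
  by rewrite -{2}(Phi_nongen (etrans (joingC _ _) defX)) genGid.
have cycH: cyclic (H / 'Phi(X)).
  have: #|H / 'Phi(X)| %| 2.
    have prH: H / 'Phi(X) \proper X / 'Phi(X).
      by rewrite quotient_proper ?Phi_normal // /normal joing_subr (subset_trans sHX).
    have := cardSg (proper_sub prH); have := proper_card prH.
    have /(dvdn_pfactor _ _ (isT : prime 2))[n n_le ->] :=
      metacyclic_Phi_index pX mX.
    move=> lt_Hn /(dvdn_pfactor _ _ (isT : prime 2))[m _ defm]; move: lt_Hn.
    rewrite defm ltn_exp2l // => lt_mn; rewrite (@dvdn_exp2l 2 m 1) //.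
    by rewrite -ltnS (leq_trans lt_mn).
  rewrite (dvdn_divisors _ (isT : 0 < 2)) !inE => /pred2P[] oH.
    by rewrite (card1_trivg oH) cyclic1.
  by rewrite prime_cyclic ?oH.
case/negP: not_cXD; apply: (coprime_cent_Phi pX) => //.
rewrite -quotient_cents2 //.
have defX: H * 'C_X(D) = X.
  by apply: coprime_cent_factor => //; rewrite ?joing_subl ?(pgroup_sol pX).
have nCX: 'C_X(D) \subset 'N('Phi(X)) by rewrite subIset ?nPhiX.
have defXb: (H / 'Phi(X)) * ('C_X(D) / 'Phi(X)) = X / 'Phi(X).
  by rewrite -quotientMr // defX.
rewrite centsC -defXb centM subsetI andbC quotient_cents; last first.
  by rewrite centsC subsetIr.
apply: odd_cent_cyclic cycH _; rewrite ?quotient_pgroup ?quotient_norms //.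
exact: pgroupS sHX pX.
Qed.

Section OddAction.

Variables (gT : finGroupType) (D X : {group gT}).
Hypotheses (pX : 2.-group X) (oddD : 2^'.-group D) (nXD : D \subset 'N(X)).
Hypothesis (XD : [~: X, D] = X).

(** The image of the power map is a cyclic subgroup on which D acts, hence acts
    trivially; as the map commutes with the action of D, its kernel contains
    [X, D] = X. *)
Lemma cyclic_power_image n (U : {group gT}) :
    {in X &, {morph (fun x => x ^+ n) : x y / x * y}} ->
    cyclic U -> {in X, forall x, x ^+ n \in U} ->
  {in X, forall x, x ^+ n = 1}.
Proof.
move=> fM cycU XnU; pose f := Morphism fM.
have cycI : cyclic (f @* X).
  by apply: cyclicS cycU; apply/subsetP=> _ /morphimP[x _ Xx ->]; apply: XnU.
have sIX : f @* X \subset X.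
  by apply/subsetP=> _ /morphimP[x _ Xx ->]; rewrite groupX.
have nID : D \subset 'N(f @* X).
  apply/subsetP=> d Dd; rewrite inE; apply/subsetP=> _ /imsetP[_ /morphimP[x _ Xx ->] ->].
  by rewrite /= conjXg; apply: (mem_morphim f); rewrite memJ_norm ?(subsetP nXD).
have cID := odd_cent_cyclic (pgroupS sIX pX) oddD cycI nID.
suffices /subsetP kerX: X \subset 'ker f by move=> x /kerX/mker.
rewrite -{1}XD gen_subG; apply/subsetP=> _ /imset2P[x d Xx Dd ->].
have Xxd : x ^ d \in X by rewrite memJ_norm ?(subsetP nXD).
rewrite commgEl; apply/kerP; first by rewrite groupM ?groupV.
rewrite morphM ?groupV // morphV //=.
rewrite -conjXg -commgEl; apply/eqP/commgP/esym.
by apply: (centsP cID); rewrite // (mem_morphim f).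
Qed.

(** X has rank at most 2, and is not cyclic unless trivial: use the identity map
    in cyclic_power_image. If X = <[x]> \x <[y]> with #[y] dividing #[x], the
    image of the power map of exponent #[y] is contained in <[x]>; so this map
    is trivial and #[x] = #[y]. *)
Lemma abelian_metacyclic_homocyclic :
  abelian X -> metacyclic X -> homocyclic2 X.
Proof.
move=> abX mX; have [b defX oB] := abelian_structure abX.
have cyc1 : cyclic X -> X :=: 1.
  move=> cycX; apply/trivgP/subsetP=> x Xx; rewrite inE -[x]expg1; apply/eqP.
  apply: cyclic_power_image cycX _ x Xx => [y z _ _ | y Xy]; rewrite ?expg1 //.
have homo1 : X :=: 1 -> homocyclic2 X.
  move=> X1; exists 1%G, 1%G; split; rewrite ?cyclic1 ?isog_refl //.
  by rewrite dprod1g X1.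
have mb : size b <= 2.
  rewrite -(size_map order) oB size_abelian_type // -grank_abelian //.
  exact: metacyclic_grank.
case: b => [|x [|y []]] // in defX oB mb *.
- by apply: homo1; rewrite -defX big_nil.
- by apply/homo1/cyc1; rewrite -defX big_seq1 cycle_cyclic.
rewrite big_cons big_seq1 in defX.
have [_ defXm _ _] := dprodP defX.
have dv_yx : #[y] %| #[x].
  by have := abelian_type_dvdn_sorted X; rewrite -oB => /andP[].
have Xy : y \in X by rewrite -defXm (subsetP (mulG_subr _ _)) ?cycle_id.
have Xx : x \in X by rewrite -defXm (subsetP (mulG_subl _ _)) ?cycle_id.
exists <[x]>%G, <[y]>%G; split=> //; rewrite ?cycle_cyclic //.
rewrite isog_cyclic_card ?cycle_cyclic // eqn_dvd.
rewrite -!orderE dv_yx /= order_dvdn; apply/eqP.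
apply: (@cyclic_power_image _ <[x]>%G _ (cycle_cyclic x) _ x Xx).
  by move=> z t Xz Xt; apply/expgMn/(centsP abX).
move=> z; rewrite -defXm => /mulsgP[_ _ /cycleP[i ->] /cycleP[j ->] ->].
rewrite expgMn; last by apply: (centsP abX); rewrite groupX.
by rewrite -2!expgM (mulnC j) (expgM y) expg_order expg1n mulg1 mem_cycle.
Qed.

End OddAction.

Lemma homocyclic2_exponent (gT : finGroupType) (X : {group gT}) :
    homocyclic2 X ->
  abelian X /\ exists2 q, #|X| = (q ^ 2)%N & exponent X %| q.
Proof.
case=> A [B [cycA cycB isoAB defX]].
have [_ defXm cAB _] := dprodP defX; have oB := card_isog isoAB.
split; first by rewrite -defXm abelianM !cyclic_abelian.
exists #|A|; first by rewrite -(dprod_card defX) -oB.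
apply/exponentP=> x; rewrite -defXm => /mulsgP[a b Aa Bb ->].
rewrite expgMn; last by apply: commute_sym; apply: (centsP cAB).
by rewrite {2}oB !expg_cardG // mulg1.
Qed.

(** If #|X| = q ^ 2 and X has exponent dividing q, then K and X / K, being
    cyclic, have order at most q. *)
Lemma homocyclic2_card_cyclic (gT : finGroupType) (X K : {group gT}) :
    homocyclic2 X -> K \subset X -> cyclic K -> cyclic (X / K) ->
  #|X| = (#|K| ^ 2)%N.
Proof.
move=> /homocyclic2_exponent[abX [q oX expX]] sKX cycK cycXK.
have nKX := sub_abelian_norm abX sKX.
have leK : #|K| %| q.
  by rewrite -(exponent_cyclic cycK) (dvdn_trans (exponentS sKX)).
have leXK : #|X / K| %| q.
  by rewrite -(exponent_cyclic cycXK) (dvdn_trans (exponent_quotient _ _)).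
rewrite oX; congr (_ ^ 2)%N; apply/eqP; rewrite eqn_dvd leK andbT.
have q_gt0 : 0 < q by case: q oX {expX leK leXK} => // /eqP; rewrite -leqn0 leqNgt cardG_gt0.
have := Lagrange sKX; rewrite oX -card_quotient // => oKX.
by rewrite -(@dvdn_pmul2r q) // mulnn -oKX dvdn_mul.
Qed.

(** In the nonabelian case X' is cyclic, so D centralizes it, and so does
    X = [X, D] by the three subgroups lemma: X has class 2. The quotient X / X'
    is homocyclic, of order (2 ^ m) ^ 2 say, and a cyclic normal subgroup
    K = <[a]> of X with cyclic quotient contains X' with index 2 ^ m. Let 2 ^ s be
    the order of X', so that #[a] = 2 ^ (m + s), and put n = 2 ^ (m + s - 1).
    If m > 1, then 2 ^ s divides 'C(n, 2), so that x |-> x ^+ n is a homomorphism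
    from X to the cyclic group X', hence trivial by cyclic_power_image; but
    a ^+ n != 1. So m = 1: squares are central, commutators have order at
    most 2, and therefore s = 1. *)
Lemma odd_action_metacyclic (gT : finGroupType) (D X : {group gT}) :
    2.-group X -> metacyclic X -> 2^'.-group D -> D \subset 'N(X) ->
    ~~ (D \subset 'C(X)) ->
  homocyclic2 X \/ #|X| = 8 /\ ~~ abelian X.
Proof.
move=> pX mX oddD nXD not_cXD.
have XD := odd_commg_metacyclic pX mX oddD nXD not_cXD.
have [abX | nabX] := boolP (abelian X).
  by left; apply: abelian_metacyclic_homocyclic XD abX mX.
right; split=> //; have [K [cycK nsKX cycXK]] := metacyclicP mX.
have [sKX nKX] := andP nsKX.
have sX'K : X^`(1) \subset K by rewrite der1_min ?cyclic_abelian.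
have cycX' := cyclicS sX'K cycK.
have sX'X : X^`(1) \subset X := der_sub 1 X.
have cX'D : D \subset 'C(X^`(1)).
  apply: odd_cent_cyclic (pgroupS sX'X pX) oddD cycX' _.
  exact: char_norm_trans (der_char 1 X) nXD.
have cX'X : X \subset 'C(X^`(1)).
  rewrite -{1}XD; apply/commG1P/(three_subgroup (G := D) (H := X^`(1)%G)).
    by move/commG1P: cX'D => ->; rewrite comm1G.
  apply/commG1P; rewrite centsC (subset_trans cX'D) // centS //.
  by rewrite commg_subl der_norm.
have nX'X := normal_norm (der_normal 1 X).
have nX'D := char_norm_trans (der_char 1 X) nXD.
have nsX'X := der_normal 1 X.
have cycXKb : cyclic (X / X^`(1) / (K / X^`(1))).
  by rewrite (isog_cyclic (third_isog sX'K nsX'X nsKX)).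
have homXb : homocyclic2 (X / X^`(1)).
  apply: (@abelian_metacyclic_homocyclic _ (D / X^`(1))%G).
  + exact: quotient_pgroup.
  + exact: quotient_pgroup.
  + by rewrite quotient_norms.
  + by rewrite -quotientR ?XD.
  + exact: der_abelian 0 X.
  apply/metacyclicP; exists (K / X^`(1))%G.
  by split; [apply: quotient_cyclic | apply: quotient_normal | apply: cycXKb].
have oXb : #|X / X^`(1)| = (#|K / X^`(1)| ^ 2)%N.
  apply: homocyclic2_card_cyclic homXb _ _ cycXKb; first exact: quotientS.
  exact: quotient_cyclic.
have [_ [q]] := homocyclic2_exponent homXb.
rewrite oXb => /eqP; rewrite eqn_exp2r // => /eqP <- {q} expXb.
have Xq x : x \in X -> x ^+ #|K / X^`(1)| \in X^`(1).
  move=> Xx; have nx := subsetP nX'X x Xx.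
  apply: coset_idr; rewrite ?groupX // morphX //.
  by apply: (exponentP expXb); apply: mem_quotient.
have [m om] := p_natP (quotient_pgroup X^`(1) (pgroupS sKX pX)).
have [s os] := p_natP (pgroupS sX'X pX).
have [a defK] := cyclicP cycK.
have s_gt0 : 0 < s.
  rewrite lt0n; apply: contra nabX => /eqP s0; apply/derG1P/card1_trivg.
  by rewrite os s0.
have oK : #|K| = (2 ^ (m + s))%N.
  rewrite expnD -om -os card_quotient ?(subset_trans sKX) // mulnC.
  by rewrite Lagrange.
have oX : #|X| = (2 ^ (m + m + s))%N.
  rewrite -(Lagrange sX'X) -card_quotient // oXb om os -expnM muln2 addnn mulnC.
  by rewrite -expnD.
have cX'c x y : x \in X -> y \in X -> forall z, z \in X -> commute z [~ x, y].
  by move=> Xx Xy z Xz; apply: (centsP cX'X); rewrite ?mem_commg.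
case: m => [|[|m]] in om oK oX *.
(* m = 0: X would be equal to its cyclic derived subgroup. *)
- have defX : X^`(1) = X by apply/eqP; rewrite eqEcard sX'X oX os /=.
  by case/negP: nabX; rewrite -defX; apply: cyclic_abelian cycX'.
(* m = 1: X' is cyclic and generated by elements of order at most 2. *)
- suffices s1 : s = 1%N by rewrite oX s1.
  have pX' := pgroupS sX'X pX.
  have oOhm : #|'Ohm_1(X^`(1))| = 2.
    by apply: Ohm1_cyclic_pgroup_prime pX' _; rewrite // -cardG_gt1 os -(expn0 2) ltn_exp2l.
  suffices sX'Ohm : X^`(1) \subset 'Ohm_1(X^`(1)).
    have := subset_leq_card sX'Ohm; rewrite oOhm os -{2}(expn1 2) leq_exp2l // => s_le1.
    by apply/eqP; rewrite eqn_leq s_le1.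
  rewrite (OhmE 1 pX') gen_subG; apply/subsetP=> _ /imset2P[x y Xx Xy ->].
  rewrite mem_gen // !inE mem_commg //= expn1 -commXg; last exact: cX'c.
  have := Xq x Xx; rewrite om => X'x2; apply/commgP/esym.
  exact: (centsP cX'X).
pose n := (2 ^ (m.+2 + s).-1)%N.
have Ka : a \in K by rewrite defK cycle_id.
have an1 : a ^+ n = 1.
  apply: (@cyclic_power_image _ _ _ pX oddD nXD XD n X^`(1)%G _ cycX' _ a (subsetP sKX a Ka)).
    move=> x y Xx Xy /=; rewrite expMg_Rmul; [|exact: cX'c..].
    have /dvdnP[k ->] : #|X^`(1)| %| 'C(n, 2).
      rewrite os bin2 /n addSn /= addSn expnS -mulnA mul2n doubleK.
      by rewrite dvdn_mulr // dvdn_exp2l // leq_addl.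
    by rewrite mulnC expgM (expg_cardG (mem_commg Xy Xx)) expg1n mulg1.
  move=> x Xx; have -> : n = (2 ^ m.+2 * 2 ^ s.-1)%N.
    by rewrite -expnD -[in RHS](prednK s_gt0) /n -{1}(prednK s_gt0) addnS.
  by rewrite expgM groupX // -om Xq.
have := order_dvdn a n; rewrite an1 eqxx orderE -defK oK.
by rewrite dvdn_Pexp2l // addSn ltnn.
Qed.

(** * Metacyclic 2-groups that contain a nonabelian group of order 8 *)

Lemma cyclic_quotient_setI (gT : finGroupType) (P K X : {group gT}) :
    K <| P -> X \subset P -> cyclic (P / K) -> cyclic (X / (X :&: K)).
Proof.
move=> /andP[sKP nKP] sXP cycPK; rewrite setIC.
rewrite (isog_cyclic (second_isog (subset_trans sXP nKP))).
by rewrite (cyclicS _ cycPK) ?quotientS.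
Qed.

(** Let K be a cyclic normal subgroup of P with cyclic quotient, and Y = X :&: K.
    As X is nonabelian and X / Y is cyclic, X does not centralize the cyclic
    group Y, which has order at most 4. Therefore #|Y| = 4 and 'C_P(Y) has
    index 2 in P. The subgroups of the cyclic 2-group P / K form a chain and
    X K / K is not contained in 'C_P(Y) / K, so P = X K and K has index 2 in P. Among the nonabelian 2-groups
    with a cyclic maximal subgroup, only the modular groups do not have maximal
    class; but in a modular group of order at least 16 the squares are
    central, so that P would centralize Y. *)
Lemma metacyclic_maximal_class (gT : finGroupType) (P X : {group gT}) :
    2.-group P -> metacyclic P -> X \subset P -> #|X| = 8 -> ~~ abelian X ->
  maximal_class2 P.
Proof.
move=> pP /metacyclicP[K [cycK nsKP cycPK]] sXP oX nabX.
have [sKP nKP] := andP nsKP.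
pose Y := (X :&: K)%G.
have sYX : Y \subset X by apply: subsetIl.
have sYK : Y \subset K by apply: subsetIr.
have cycY : cyclic Y := cyclicS sYK cycK.
have cycXY : cyclic (X / Y) by apply: cyclic_quotient_setI cycPK.
have nYP : P \subset 'N(Y).
  by apply: char_norm_trans nKP; rewrite sub_cyclic_char.
have not_cXY : ~~ (X \subset 'C(Y)).
  apply: contra nabX => cXY; apply: cyclic_factor_abelian cycXY.
  by rewrite subsetI sYX centsC.
have iPC_dvd : #|P : 'C_P(Y)| %| totient #|Y| := index_cent_cyclic cycY nYP.
have iPC1 : #|P : 'C_P(Y)| != 1%N.
  apply: contra not_cXY; rewrite indexg_eq1 subsetI subxx; exact: subset_trans.
have [oY iPC] : #|Y| = 4 /\ #|P : 'C_P(Y)| = 2.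
  have := cardSg sYX; rewrite oX => /(@dvdn_pfactor 2 _ 3 isT)[k lek oYk].
  have k3 : k != 3.
    apply: contra nabX => /eqP k3; have/eqP <- : Y == X :> {set gT}.
      by rewrite eqEcard sYX oYk oX k3.
    exact: cyclic_abelian.
  move: iPC_dvd iPC1; rewrite oYk; case: k lek k3 {oYk} => [|[|[|[|]]]] // _ _.
  - by rewrite dvdn1 => ->.
  - by rewrite dvdn1 => ->.
  by rewrite (dvdn_divisors _ (isT : 0 < 2)) !inE => /pred2P[] ->.
have sKC : K \subset 'C_P(Y).
  by rewrite subsetI sKP sub_abelian_cent ?cyclic_abelian.
have defP : X / K = P / K.
  have pPK : 2.-group (P / K) := quotient_pgroup K pP.
  have [i oPK] := p_natP pPK.
  have sXPK : X / K \subset P / K := quotientS K sXP.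
  have [j oXK] := p_natP (pgroupS sXPK pPK).
  have oCK : (2 * #|'C_P(Y) / K| = 2 ^ i)%N.
    rewrite -oPK !card_quotient ?(subset_trans (subsetIl _ _)) //.
    by rewrite -iPC Lagrange_index ?subsetIl.
  case: i => [|i] in oPK oCK *.
    by case/eqP: oCK; rewrite gtn_eqF // expn0 (@leq_mul 2 1).
  have {}oCK : #|'C_P(Y) / K| = (2 ^ i)%N.
    by apply/eqP; rewrite -(@eqn_pmul2l 2) // oCK expnS.
  apply/eqP; rewrite eqEcard sXPK oPK oXK leq_exp2l //= leqNgt.
  apply: contra not_cXY => lt_ji.
  have : X / K \subset 'C_P(Y) / K.
    rewrite -(cardSg_cyclic cycPK) ?quotientS ?subsetIl // oXK oCK.
    by rewrite dvdn_exp2l.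
  rewrite (quotientSK _ (subset_trans sXP nKP)) /= mulSGid // => sXC.
  by apply: subset_trans sXC (subsetIr _ _).
have iPK : #|P : K| = 2.
  rewrite -card_quotient // -defP card_quotient ?(subset_trans sXP) //.
  by rewrite -indexgI -divgS // oX oY.
have nabP : ~~ abelian P by apply: contra nabX; apply: abelianS.
have P_ge8 : 8 <= #|P| by rewrite -oX subset_leq_card.
have := maximal_cycle_extremal pP nabP cycK sKP iPK.
case/orP=> [/eqP/modular_group_classP[q q_pr [m m_gt isoM]] | /=].
  have m_gt2 : 2 < m by apply: leq_trans m_gt; apply: leq_addl.
  (* The modular case: here 'Z(P) = 'Mho^1(P) contains the subgroup of index 2
     of K, which has order at least 4 and therefore contains Y. *)
  have [[x y] genP modP] := generators_modular_group q_pr m_gt2 isoM.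
  have [_ [defZ _ _] _ defMho _] := modular_group_structure q_pr m_gt2 genP isoM modP.
  have oP := card_isog isoM; rewrite card_modular_group // in oP.
  have q2 : q = 2.
    have := pP; rewrite /pgroup oP pnatX orbC -implyNb -lt0n.
    by rewrite (ltn_trans _ m_gt2) // pnatE // => /eqP.
  case/negP: not_cXY; rewrite centsC; apply: subset_trans (centS sXP).
  suffices: Y \subset 'Z(P) by rewrite subsetI => /andP[].
  rewrite defZ -(expn1 q) -defMho //.
  have [a defK] := cyclicP cycK.
  have Ma : a ^+ 2 \in 'Mho^1(P).
    apply: (Mho_p_elt 1 (p := 2)); first by rewrite (subsetP sKP) ?defK ?cycle_id.
    by rewrite (mem_p_elt pP) // (subsetP sKP) ?defK ?cycle_id.
  rewrite -cycle_subG in Ma; apply: subset_trans Ma.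
  have sa2K : <[a ^+ 2]> \subset K by rewrite defK cycleX.
  have := Lagrange sKP; rewrite iPK oP q2 => oK2.
  rewrite -(cardSg_cyclic cycK) // oY.
  move: m_gt oK2; rewrite q2 /=; case: (m) => [|[|[|[|k]]]] // _.
  rewrite expnSr => /eqP; rewrite eqn_pmul2r // defK -!orderE => /eqP oa.
  by rewrite orderXdiv oa // expnS ?dvdn_mulr // mulKn // !expnS mulnA dvdn_mulr.
rewrite /extremal2 => ext; apply/maximal_class2P.
case def_c: (extremal_class P) ext => // _.
+ case/dihedral_classP: def_c => m m_gt isoP; constructor 1; exists m => //.
  by move: P_ge8; rewrite (card_isog isoP) card_2dihedral // (@leq_exp2l 2 3).
+ by case/semidihedral_classP: def_c => m; constructor 2; exists m.
by case/quaternion_classP: def_c => m; constructor 3; exists m.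
Qed.

(** * Odd-order automorphisms in the normalizers of 2-subgroups *)

(** Let K be a cyclic normal subgroup of R with cyclic quotient. If K lies in X,
    then its image in R / 'Phi(X) has order at most 2, hence is central, and
    R / 'Phi(X) is abelian. Otherwise R = X K with K = <[a]>. By
    homocyclic2_card_cyclic, #|K| = 2q where #|X| = q ^ 2, and 4 divides q. As
    a ^+ 2 lies in the abelian group X, for b in X the commutator [~ a, b] is an
    element of K of order at most 2, so it is a fourth power in K, that is, the
    square of an element of X. *)
Lemma commg_homocyclic_index2 (gT : finGroupType) (R X : {group gT}) :
    2.-group R -> metacyclic R -> X \subset R -> #|R : X| = 2 ->
    homocyclic2 X -> 4 < #|X| ->
  [~: X, R] \subset 'Phi(X).
Proof.
move=> pR /metacyclicP[K [cycK nsKR cycRK]] sXR iRX homX X_gt4.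
have [[sKR nKR] pX] := (andP nsKR, pgroupS sXR pR).
have [abX _] := homocyclic2_exponent homX.
have nsXR : X <| R := index2_normal sXR iRX.
have nPhiR : R \subset 'N('Phi(X)).
  exact: char_norm_trans (Phi_char X) (normal_norm nsXR).
have nPhiX := subset_trans sXR nPhiR; have nPhiK := subset_trans sKR nPhiR.
have abelX := Phi_quotient_abelem pX.
rewrite -quotient_cents2 //.
have [sKX | not_sKX] := boolP (K \subset X).
  have cKR : R / 'Phi(X) \subset 'C(K / 'Phi(X)).
    have cycKb : cyclic (K / 'Phi(X)) := quotient_cyclic _ cycK.
    have abelK := abelemS (quotientS 'Phi(X) sKX) abelX.
    have := index_cent_cyclic cycKb (quotient_norms _ nKR).
    have -> : totient #|K / 'Phi(X)| = 1%N.
      have [-> | ntK] := eqVneq (K / 'Phi(X)) 1; first by rewrite cards1.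
      by rewrite (cyclic_abelem_prime abelK).
    by rewrite dvdn1 indexg_eq1 subsetI => /andP[].
  suffices abR : abelian (R / 'Phi(X)) by apply: subset_trans (quotientS _ sXR) abR.
  have [tb defRK] := cyclicP cycRK.
  have /morphimP[t Nt Rt def_t] : tb \in R / K by rewrite defRK cycle_id.
  have defR : K * <[t]> = R.
    rewrite -quotientK ?cycle_subG // quotient_cycle // -def_t -defRK.
    by rewrite quotientGK.
  have sTR : <[t]> \subset R by rewrite cycle_subG.
  rewrite -defR quotientMl // abelianM !quotient_abelian ?cyclic_abelian ?cycle_cyclic //=.
  exact: subset_trans (quotientS _ sTR) cKR.
have maxX : maximal X R by apply: p_index_maximal; rewrite ?iRX.
have defR : X * K = R.
  exact: mulg_normal_maximal.
have [a defK] := cyclicP cycK.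
have Ka : a \in K by rewrite defK cycle_id.
have Ra := subsetP sKR a Ka.
have Xa2 : a ^+ 2 \in X.
  have Na := subsetP (normal_norm nsXR) a Ra.
  apply: coset_idr; rewrite ?groupX // morphX //; apply/eqP.
  by rewrite -order_dvdn -iRX -card_quotient ?normal_norm // order_dvdG ?mem_quotient.
have oX : #|X| = (#|X :&: K| ^ 2)%N.
  apply: homocyclic2_card_cyclic (subsetIl _ _) (cyclicS (subsetIr _ _) cycK) _ => //.
  exact: cyclic_quotient_setI cycRK.
have oK : #|K| = (#|X :&: K| * 2)%N.
  have := mul_cardG X K; rewrite defR -(Lagrange sXR) iRX -mulnA => /eqP.
  by rewrite eqn_pmul2l ?cardG_gt0 // mulnC => /eqP.
have dv4 : 4 %| #|X :&: K|.
  have [k oY] := p_natP (pgroupS (subsetIl X K) pX).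
  move: X_gt4; rewrite oX oY -expnM -[4]/(2 ^ 2)%N ltn_exp2l //.
  rewrite muln2 -[2]/(1.*2) ltn_double => k_gt1.
  by rewrite (@dvdn_exp2l 2 2).
rewrite -defR quotientMl // centM subsetI; apply/andP; split.
  exact: quotient_abelian.
rewrite /= defK quotient_cycle ?(subsetP nPhiR) // cent_cycle.
apply/subsetP=> _ /morphimP[b Nb Xb ->]; apply/cent1P.
have Kab : [~ a, b] \in K.
  by rewrite commgEl groupM ?groupV // memJ_norm // (subsetP nKR) ?(subsetP sXR).
have ab2 : [~ a, b] ^+ 2 = 1.
  rewrite -commXg; last by apply: (centsP (cyclic_abelian cycK)).
  by apply/eqP/commgP/(centsP abX).
suffices Phi_ab : [~ a, b] \in 'Phi(X).
  apply/esym/commgP; rewrite -morphR ?(subsetP nPhiR) //; last exact: (subsetP sXR).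
  by rewrite /= coset_id.
move: Kab ab2; rewrite defK => /cycleP[i ->] /eqP.
rewrite -expgM -order_dvdn orderE -defK oK dvdn_pmul2r // => /(dvdn_trans dv4).
case/dvdnP=> j ->; have -> : (j * 4 = 2 * j * 2)%N.
  by rewrite -[4]/(2 * 2)%N mulnA (mulnC j).
rewrite !expgM (Phi_Mho pX abX); have Xa2j := groupX j Xa2.
exact: (Mho_p_elt 1 (p := 2)) Xa2j (mem_p_elt pX Xa2j).
Qed.

(** Induction on #|G| - #|X|, so that the property may be assumed for the
    2-subgroups X1 that properly contain X. *)
Lemma metacyclic_locally_central (gT : finGroupType) (G : {group gT}) :
    (forall P : {group gT}, 2.-Sylow(G) P ->
      [/\ metacyclic P, ~ maximal_class2 P & ~ homocyclic2 P]) ->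
  p'_locally_central 2 G.
Proof.
move=> hG X; have [n] := ubnP (#|G| - #|X|); elim: n => // n IHn in X *.
rewrite ltnS => leXn D sXG pX sDN oddD; apply/idPn=> not_cXD.
have {}IHn (X1 D1 : {group gT}) : X \proper X1 -> X1 \subset G -> 2.-group X1 ->
  D1 \subset 'N_G(X1) -> 2^'.-group D1 -> D1 \subset 'C(X1).
- move=> prX1 sX1G; apply: IHn => //; apply: leq_trans leXn; apply: ltn_sub2l.
    exact: leq_trans (proper_card prX1) (subset_leq_card sX1G).
  exact: proper_card.
pose N := 'N_G(X)%G; have nsXN : X <| N by rewrite /normal subsetI sXG normG subsetIr.
have [R sylR] := Sylow_exists 2 N; have [sRN pR _] := and3P sylR.
have sXR : X \subset R := normal_sub_max_pgroup (Hall_max sylR) pX nsXN.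
have [P sylP sRP] := Sylow_superset (subset_trans sRN (subsetIl _ _)) pR.
have [mP not_maxP not_homP] := hG P sylP; have [sPG pP _] := and3P sylP.
have sXP := subset_trans sXR sRP.
have [_ nXD] := subsetIP sDN.
have mX := metacyclicS sXP mP.
have [homX | [oX nabX]] := odd_action_metacyclic pX mX oddD nXD not_cXD; last first.
  exact: not_maxP (metacyclic_maximal_class pP mP sXP oX nabX).
have prXR : X \proper R.
  have <- : 'N_P(X) = R.
    apply: (sub_pHall sylR); rewrite ?setSI ?(pgroupS (subsetIl _ _)) //.
    by rewrite subsetI sRP (subset_trans sRN) ?subsetIr.
  apply: nilpotent_proper_norm (pgroup_nil pP) _; rewrite properEneq sXP andbT.
  by apply: contra_notN not_homP => /eqP/val_inj <-.
(* C0 is the kernel of the action of 'N_G(X) on X / 'Phi(X). *)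
pose W := 'Phi(X)%G; pose C0 := (N :&: coset W @*^-1 'C(X / W))%G.
have nWN : N \subset 'N(W) := char_norm_trans (Phi_char X) (subsetIr _ _).
have sXN := normal_sub nsXN; have nWX := subset_trans sXN nWN.
have C0E (A : {group gT}) : A \subset N -> (A \subset C0) = ([~: X, A] \subset W).
  move=> sAN; have nWA := subset_trans sAN nWN.
  by rewrite subsetI sAN -sub_quotient_pre // centsC quotient_cents2.
have nsC0 : C0 <| N.
  rewrite /normal subsetIl normsI ?normG //.
  apply: subset_trans (morphpre_norm _ _); rewrite -sub_quotient_pre //.
  by rewrite norms_cent // quotient_norms ?subsetIr.
have sylR0 : 2.-Sylow(C0) (C0 :&: R) := Sylow_setI_normal nsC0 sylR.
have sXC0 : X \subset C0.
  rewrite C0E // -quotient_cents2 //.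
  exact: abelem_abelian (Phi_quotient_abelem pX).
have coXD : coprime #|X| #|D| := pnat_coprime pX oddD.
(* If the Sylow 2-subgroup C0 :&: R of C0 were larger than X, then by the
   choice of X its normalizer would induce a 2-group on it, hence on X / 'Phi(X).
   By the Frattini argument so would N, and D would centralize X. *)
have R0X : C0 :&: R \subset X.
  apply: contraR not_cXD => not_sR0X; apply: (coprime_cent_Phi pX) => //.
  rewrite -C0E //.
  have prXR0 : X \proper (C0 :&: R)%G by rewrite properE subsetI sXC0 sXR.
  have pNC : 2.-group (N / C0).
    rewrite -(Frattini_arg nsC0 sylR0) quotientMidl.
    apply: pgroup_quotient_p'sub => [|D1 sD1 oddD1].
      by rewrite subIset ?(normal_norm nsC0).
    have [sD1N nD1] := subsetIP sD1.
    rewrite C0E //; suffices /commG1P-> : X \subset 'C(D1) by apply: sub1G.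
    rewrite centsC; apply: subset_trans (centS (proper_sub prXR0)).
    apply: IHn => //.
    - by rewrite subIset // (subset_trans (subsetIl _ _)) ?subsetIl.
    - exact: pgroupS (subsetIr _ _) pR.
    by rewrite subsetI nD1 (subset_trans sD1N) ?subsetIl.
  have nC0D := subset_trans sDN (normal_norm nsC0).
  rewrite -quotient_sub1 // subG1 trivg_card1; apply/eqP/(@pnat_1 2).
    exact: pgroupS (quotientS _ sDN) pNC.
  exact: quotient_pgroup.
have nsXR : X <| R := normalS sXR sRN nsXN.
have [R1 [sXR1 sR1R iR1]] :
    exists R1 : {group gT}, [/\ X \subset R1, R1 \subset R & #|R1 : X| = 2].
  have pRX : 2.-group (R / X) := quotient_pgroup X pR.
  have ntRX : R / X != 1.
    by rewrite -subG1 quotient_sub1 ?normal_norm // proper_subn.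
  have [_ dv2 _] := pgroup_pdiv pRX ntRX.
  have [xb Rxb oxb] := Cauchy (isT : prime 2) dv2.
  have sxbR : <[xb]> \subset R / X by rewrite cycle_subG.
  have [R1 defR1 sXR1 sR1R] := inv_quotientS nsXR sxbR.
  exists R1; split=> //; rewrite -card_quotient ?(subset_trans sR1R) ?normal_norm //.
  by rewrite -defR1 -orderE.
have not_cR1 : ~~ ([~: X, R1] \subset W).
  rewrite -(C0E R1 (subset_trans sR1R sRN)); apply/negP=> sR1C0.
  have : R1 \subset X by apply: subset_trans R0X; apply/subsetIP.
  by rewrite -indexg_eq1 iR1.
case/negP: not_cR1; have [X_gt4 | X_le4] := ltnP 4 #|X|.
  apply: commg_homocyclic_index2 => //; first exact: pgroupS pR.
  exact: metacyclicS (subset_trans sR1R sRP) mP.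
have oX4 : #|X| = 4.
  have [_ [q oX _]] := homocyclic2_exponent homX.
  have ntX : 1 < #|X|.
    rewrite cardG_gt1; apply: contra not_cXD => /eqP->; exact: cents1.
  by move: ntX X_le4; rewrite oX; case: (q) => [|[|[|k]]] //; rewrite -[4]/(2 ^ 2)%N leq_exp2r.
have [abR1 | nabR1] := boolP (abelian R1).
  suffices /commG1P-> : X \subset 'C(R1) by apply: sub1G.
  exact: subset_trans sXR1 abR1.
case: not_maxP; apply: metacyclic_maximal_class nabR1 => //.
  exact: subset_trans sR1R sRP.
by rewrite -(Lagrange sXR1) iR1 oX4.
Qed.

Theorem mainTheorem2 (gT : finGroupType) (G : {group gT})
    (hG : forall P : {group gT}, 2.-Sylow(G) P ->
      [/\ metacyclic P, ~ maximal_class2 P & ~ homocyclic2 P]) :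
  two_nilpotent G.
Proof.
exists 'O_2^'(G)%G; split; first exact: pcore_normal.
  by rewrite odd_2'nat; apply: pcore_pgroup.
exact: Frobenius_normal_complement (metacyclic_locally_central hG).
Qed.
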